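(* Consider the predictive experimental design problem described in the context, with loss function $L$ having domain $\mathcal{P}$, and let $S$, $H$, $D$ and $C$ be the scoring rule, uncertainty function, discrepancy function and dependence function derived from $L$. For an experiment $\xi^*\in\Xi$ the following are equivalent: (i) $\xi^*$ minimises over $\xi\in\Xi$ the minimal overall expected loss $\inf_{\delta}E\{L(Z,\delta(Y_\xi))\mid\xi\}$, the infimum being over decision rules $\delta:\mathcal{Y}_\xi\to\mathcal{A}$; (ii) $\xi^*$ minimises over $\xi\in\Xi$ the quantity $\inf_{\delta}E\{S(Z,\delta(Y_\xi))\mid\xi\}$, the infimum being over decision rules $\delta:\mathcal{Y}_\xi\to\mathcal{P}$; (iii) $\xi^*$ minimises over $\xi\in\Xi$ the expected predictive uncertainty $E\{H(P^Z_{\xi,Y})\mid\xi\}$; (iv) $\xi^*$ minimises over $\xi\in\Xi$ the expected discrepancy $E\{D(P^Z_\Theta,P^Z_{\xi,Y})\mid\xi\}$ between the sampling distribution and the predictive distribution of $Z$; (v) $\xi^*$ maximises over $\xi\in\Xi$ the dependence $C(P^{Z,Y})$ between $Z$ and $Y=Y_\xi$, computed under experiment $\xi$.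
   Context: Decision problem. $\mathcal{Z}$ is the space of values of $Z$, $\mathcal{A}$ an action space, $L:\mathcal{Z}\times\mathcal{A}\to(-\infty,\infty]$ a loss function. $\mathcal{P}$ is a family of probability distributions on $\mathcal{Z}$, convex in the sense that $E(\tilde P)\in\mathcal{P}$ for every random element $\tilde P$ of $\mathcal{P}$. With $L(P,a):=E_P\{L(Z,a)\}$, that $L$ has domain $\mathcal{P}$ means: $L(P,a)$ exists (possibly infinite) for all $P\in\mathcal{P}$, $a\in\mathcal{A}$; $H(P):=\inf_{a}L(P,a)$ is finite for every $P\in\mathcal{P}$; and the infimum is attained at a Bayes act $a(P)$ (a fixed choice if not unique). Derived functions: $S(z,Q):=L\{z,a(Q)\}$, $S(P,Q):=E_P\{S(Z,Q)\}$, $D(P,Q):=S(P,Q)-H(P)$, and, for a joint distribution $P^{Z,U}$ of $(Z,U)$ whose conditional distribution $P^Z_U$ of $Z$ given $U$ lies in $\mathcal{P}$ almost surely, $C(P^{Z,U}):=H(P^Z)-E\{H(P^Z_U)\}$. Design problem. A parameter $\Theta$ has a fixed prior distribution $\Pi$, the same for all experiments. Given $\Theta=\theta$, $Z$ has distribution $P^Z_\theta\in\mathcal{P}$. $\Xi$ is a set of experiments; if $\xi\in\Xi$ is performed one observes $Y=Y_\xi$ with values in $\mathcal{Y}_\xi$, having distribution $P^Y_{\theta,\xi}$ given $\Theta=\theta$. In each experiment, $Z$ and $Y$ are conditionally independent given $\Theta$, and the distribution of $Z$ given $\Theta$ is not affected by $\xi$ or by the action taken. After observing $Y=y$ an action is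 chosen, then $Z=z$ is observed and the loss is incurred. $P^Z_{\xi,y}$ denotes the predictive distribution of $Z$ given $Y=y$ in $\xi$, and $P^Z_{\xi,Y}\in\mathcal{P}$ almost surely. $P^Z$ denotes the marginal distribution of $Z$. Expectations $E\{\cdot\mid\xi\}$ are over the joint distribution of $(\Theta,Y,Z)$ in experiment $\xi$. Standing assumptions: $E\{H(P^Z_{\xi,Y})\mid\xi\}$ (for every $\xi\in\Xi$) and $E\{H(P^Z_\Theta)\}$ are finite; all functions (including decision rules and $P\mapsto a(P)$) are measurable as needed for these expectations. *)

(* Defs.v *)
From HB Require Import structures.
From mathcomp Require Import all_boot all_order all_algebra.
From mathcomp Require Import all_classical all_reals all_analysis.
From mathcomp Require Import measurable_realfun.

Set Implicit Arguments.
Unset Strict Implicit.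
Unset Printing Implicit Defensive.

Import Order.TTheory GRing.Theory Num.Theory.
Local Open Scope classical_set_scope.
Local Open Scope ring_scope.
Local Open Scope ereal_scope.

HB.instance Definition _ d1 d2 (T1 : measurableType d1)
    (T2 : measurableType d2) :=
  isMeasurableFun.Build _ _ (T1 * T2)%type T1 fst measurable_fst.

HB.instance Definition _ d1 d2 (T1 : measurableType d1)
    (T2 : measurableType d2) :=
  isMeasurableFun.Build _ _ (T1 * T2)%type T2 snd measurable_snd.

Section pairing.
Context d d1 d2 (W : measurableType d) (T1 : measurableType d1)
  (T2 : measurableType d2).
Variables (f : {mfun W >-> T1}) (g : {mfun W >-> T2}).

Definition pairing (w : W) : T1 * T2 := (f w, g w).

Let measurable_pairing : measurable_fun [set: W] pairing.
Proof. by apply: measurable_fun_pair; exact: measurable_funPT. Qed.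

HB.instance Definition _ :=
  isMeasurableFun.Build _ _ W (T1 * T2)%type pairing measurable_pairing.

End pairing.

Section decision_problem.
Context (R : realType) dZ (Z : measurableType dZ).

(* [\int[mu]_x f x] is a total function, equal to -oo when f^\+ and f^\- both
   have infinite integrals: that case is what this predicate excludes. *)
Definition expectation_exists dW (W : measurableType dW)
    (mu : {measure set W -> \bar R}) (f : W -> \bar R) :=
  (\int[mu]_x f^\+ x) +? - (\int[mu]_x f^\- x).

(* [W] and [k] are the sample space and the random element, [Q] is [E(k)]. Two
   terms of type [probability Z R] may differ on nonmeasurable sets, hence the
   quantification over all [Q] with the right values on measurable sets. *)
Definition convex_family (PP : set (pprobability Z R)) :=
  forall dW (W : measurableType dW) (mu : probability W R)
    (k : {mfun W >-> pprobability Z R}), (forall w, PP (k w)) ->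
  forall Q : pprobability Z R,
    (forall C, measurable C -> Q C = \int[mu]_w k w C) -> PP Q.

Section loss.
Context dA (A : measurableType dA).
Variable L : Z -> A -> \bar R.

Definition expected_loss (P : pprobability Z R) (a : A) : \bar R :=
  \int[P]_z L z a.

Definition uncertainty (P : pprobability Z R) : \bar R :=
  ereal_inf [set expected_loss P a | a in [set: A]].

Variable act : pprobability Z R -> A.

(* [act P] is the chosen Bayes act; only its values on [PP] matter. *)
Definition has_domain (PP : set (pprobability Z R)) :=
  forall P, PP P ->
  [/\ forall a, expectation_exists P (L ^~ a),
      uncertainty P \is a fin_num &
      expected_loss P (act P) = uncertainty P].

(* Measurability of the restriction of [act] to [PP], for the trace of the
   sigma-algebra of [pprobability Z R]. [measurable_fun PP act] would not do:
   it holds vacuously if [PP] is not measurable. *)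
Definition measurable_selection (PP : set (pprobability Z R)) :=
  forall B, measurable B ->
  exists2 V, measurable V & PP `&` act @^-1` B = PP `&` V.

Definition score (z : Z) (Q : pprobability Z R) : \bar R := L z (act Q).

Definition expected_score (P Q : pprobability Z R) : \bar R :=
  \int[P]_z score z Q.

Definition discrepancy (P Q : pprobability Z R) : \bar R :=
  expected_score P Q - uncertainty P.

(* [k] is a version of the conditional distribution of the first coordinate
   given the second one under [PZU], see [conditional_distribution]. *)
Definition dependence dU (U : measurableType dU)
    (PZU : probability (Z * U)%type R) (k : U -> pprobability Z R) : \bar R :=
  uncertainty (distribution PZU fst)
  - \int[distribution PZU snd]_u uncertainty (k u).

End loss.
End decision_problem.

Section conditioning.
Context d dU dV dT (R : realType) (W : measurableType d)
  (U : measurableType dU) (V : measurableType dV) (T : measurableType dT).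
Variable Pr : probability W R.

Definition conditional_distribution (X : {mfun W >-> U}) (Y : {mfun W >-> V})
    (k : {mfun U >-> pprobability V R}) :=
  forall B C, measurable B -> measurable C ->
  Pr (X @^-1` B `&` Y @^-1` C) = \int[Pr]_(w in X @^-1` B) k (X w) C.

(* [X] and [Y] are conditionally independent given [S], where [kX] and [kY]
   are versions of their conditional distributions given [S]:
   P(X \in B, Y \in C | S) = P(X \in B | S) P(Y \in C | S) a.s. *)
Definition conditionally_independent (S : {mfun W >-> T})
    (X : {mfun W >-> U}) (Y : {mfun W >-> V})
    (kX : {mfun T >-> pprobability U R}) (kY : {mfun T >-> pprobability V R}) :=
  forall A B C, measurable A -> measurable B -> measurable C ->
  Pr (S @^-1` A `&` (X @^-1` B `&` Y @^-1` C)) =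
  \int[Pr]_(w in S @^-1` A) (kX (S w) B * kY (S w) C).

End conditioning.

(* The prior [Pi] and the sampling distributions [PZ] of Z given the parameter
   are parameters, shared by all experiments. *)
Record experiment (R : realType) dZ (Z : measurableType dZ)
    dT (T : measurableType dT) (PP : set (pprobability Z R))
    (Pi : probability T R) (PZ : {mfun T >-> pprobability Z R}) := Experiment {
  sample_display : measure_display;
  sample : measurableType sample_display;
  Pr : probability sample R;
  obs_display : measure_display;
  obs : measurableType obs_display;
  rv_theta : {RV Pr >-> T};
  rv_Y : {RV Pr >-> obs};
  rv_Z : {RV Pr >-> Z};
  PY : {mfun T >-> pprobability obs R};
  predictive : {mfun obs >-> pprobability Z R};
  theta_prior : forall A, measurable A -> distribution Pr rv_theta A = Pi A;
  Z_given_theta : conditional_distribution Pr rv_theta rv_Z PZ;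
  Y_given_theta : conditional_distribution Pr rv_theta rv_Y PY;
  YZ_indep : conditionally_independent Pr rv_theta rv_Y rv_Z PY PZ;
  Z_given_Y : conditional_distribution Pr rv_Y rv_Z predictive;
  predictive_in : {ae distribution Pr rv_Y, forall y, PP (predictive y)}
}.

Section criteria.
Context (R : realType) dZ (Z : measurableType dZ) dT (T : measurableType dT)
  dA (A : measurableType dA) (L : Z -> A -> \bar R)
  (act : pprobability Z R -> A) (PP : set (pprobability Z R))
  (Pi : probability T R) (PZ : {mfun T >-> pprobability Z R}).
Implicit Type xi : experiment PP Pi PZ.

(* In the two infima, decision rules without an expected loss are left out. *)
Definition minimal_expected_loss xi : \bar R :=
  ereal_inf [set \int[Pr xi]_w L (rv_Z xi w) (delta (rv_Y xi w)) |
    delta in [set delta : {mfun obs xi >-> A} |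
      expectation_exists (Pr xi)
        (fun w => L (rv_Z xi w) (delta (rv_Y xi w)))]].

Definition minimal_expected_score xi : \bar R :=
  ereal_inf [set \int[Pr xi]_w score L act (rv_Z xi w) (delta (rv_Y xi w)) |
    delta in [set delta : {mfun obs xi >-> pprobability Z R} |
      (forall y, PP (delta y)) /\
      expectation_exists (Pr xi)
        (fun w => score L act (rv_Z xi w) (delta (rv_Y xi w)))]].

Definition expected_uncertainty xi : \bar R :=
  \int[Pr xi]_w uncertainty L (predictive xi (rv_Y xi w)).

Definition expected_discrepancy xi : \bar R :=
  \int[Pr xi]_w
    discrepancy L act (PZ (rv_theta xi w)) (predictive xi (rv_Y xi w)).

Definition dependence_ZY xi : \bar R :=
  dependence L (distribution (Pr xi) (pairing (rv_Z xi) (rv_Y xi)))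
    (predictive xi).

End criteria.

(* Main.v *)
Require Import Defs.
From HB Require Import structures.
From mathcomp Require Import all_boot all_order all_algebra.
From mathcomp Require Import all_classical all_reals all_analysis.
From mathcomp Require Import measurable_realfun giry lra.

Set Implicit Arguments.
Unset Strict Implicit.
Unset Printing Implicit Defensive.

Import Order.TTheory GRing.Theory Num.Theory.
Local Open Scope classical_set_scope.
Local Open Scope ring_scope.
Local Open Scope ereal_scope.

(** Let [EH xi] be the expected predictive uncertainty of the experiment [xi].
    Each criterion is an affine function of [EH xi] with a slope of 1 or -1 and
    a finite constant that is common to all experiments ([design_criteria]),
    so that all have the same optimal designs.

    Minimal expected loss and score. Conditionally on the observation [y], no
    act does better than the Bayes act against the predictive distribution,
    whose expected loss is its uncertainty. So every rule with an expected loss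
    has risk at least [EH xi] ([uncertainty_le_risk]). The Bayes rule itself
    may fail to have an expected loss, even though [EH xi] is finite: large
    gains and losses may cancel given each [y] only. It is therefore used on
    the event that, given [y], the expected gain and loss are at most [n], and
    elsewhere it is replaced by the Bayes act against the marginal law of [Z],
    which lies in the family by convexity and has an integrable loss
    ([truncated_bayes_risk]). The risks of these rules tend to [EH xi], which
    is thus the infimum ([ereal_inf_loss], [ereal_inf_score]).

    Expected discrepancy. By conditional independence, the sampling
    distribution is the conditional distribution of [Z] given the parameter and
    the observation ([conditional_distribution_pairing]). So the expected score
    of the predictive distribution has the same mean under the sampling
    distribution as under the predictive distribution, namely [EH xi], and the
    expected discrepancy is [EH xi] minus the expected uncertainty of the
    sampling distribution, which depends on the prior only
    ([integral_discrepancy]). Subtraction is legitimate on the truncating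
    events, and passes to the limit since the discrepancy is nonnegative.

    Dependence. It is the uncertainty of the marginal law of [Z] minus [EH xi],
    and this law is the prior mean of the sampling distributions
    ([predictive_marginal]).

    The predictive distribution lies in the family almost surely only, and the
    Bayes act is controlled on the family only, so that some integrands need
    not be measurable. Their integrals are unaffected by what happens on a null
    set ([integral_eq_off_null]), which allows replacing the predictive
    distribution by a version with all values in the family
    ([patched_predictive]). *)

(** * Integrals, null sets and exhaustions *)

Section null_sets.
Context d (W : measurableType d) (R : realType) (mu : {measure set W -> \bar R}).

Import HBNNSimple.

(** The integral of a nonnegative function is a supremum over simple functions
    below it, and a simple function may be cut off on a null set without
    changing its integral. This holds for functions that are not measurable,
    as integrands involving the Bayes act may be where the predictive
    distribution leaves the family. *)
Lemma ge0_integral_le_off_null (N : set W) (f g : W -> \bar R) :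
  measurable N -> mu N = 0 -> (forall w, 0 <= f w) -> (forall w, 0 <= g w) ->
  (forall w, ~ N w -> f w <= g w) -> \int[mu]_w f w <= \int[mu]_w g w.
Proof.
move=> mN N0 f0 g0 fg; rewrite !ge0_integralTE//.
apply: ge_ereal_sup => _ [h /= hf <-]; apply: ereal_sup_ubound => /=.
exists (proj_nnsfun h (measurableC mN)).
  move=> w; rewrite /= mindicE; have [Nw|Nw] := pselect (N w).
    by rewrite memNset ?mulr0//= => /(_ Nw).
  by rewrite mem_set// mulr1 (le_trans (hf w))// fg.
rewrite -!integralT_nnsfun; apply: ge0_ae_eq_integral => //.
- exact/measurable_EFinP.
- exact/measurable_EFinP.
- by move=> w _; rewrite lee_fin.
- by move=> w _; rewrite lee_fin.
exists N; split => // w /= /not_implyP[_]; apply: contra_notP => Nw.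
by rewrite mindicE mem_set// mulr1.
Qed.

Lemma integral_eq_off_null (N : set W) (f g : W -> \bar R) :
  measurable N -> mu N = 0 -> (forall w, ~ N w -> f w = g w) ->
  \int[mu]_w f w = \int[mu]_w g w.
Proof.
move=> mN N0 fg; rewrite integralE [RHS]integralE; congr (_ - _);
  by apply/eqP; rewrite eq_le; apply/andP; split;
  apply: (ge0_integral_le_off_null mN N0) => // w Nw;
  rewrite ?funeposE ?funenegE fg.
Qed.

End null_sets.

Section exhaustion.
Context d (W : measurableType d) (R : realType) (mu : {measure set W -> \bar R}).
Variable F : (set W)^nat.
Hypotheses (mF : forall n, measurable (F n)) (ndF : nondecreasing_seq F)
  (covF : \bigcup_n F n = setT).

Lemma ge0_cvg_integral_exhaustion (f : W -> \bar R) :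
  measurable_fun setT f -> (forall w, 0 <= f w) ->
  \int[mu]_(w in F n) f w @[n --> \oo] --> \int[mu]_w f w.
Proof.
move=> mf f0; rewrite -covF; apply: ge0_nondecreasing_set_cvg_integral => //.
by move=> n; exact: measurable_funTS.
Qed.

(** Dominated convergence along an exhaustion, from the positive and negative
    parts. *)
Lemma cvg_integral_exhaustion (f : W -> \bar R) : mu.-integrable setT f ->
  \int[mu]_(w in F n) f w @[n --> \oo] --> \int[mu]_w f w.
Proof.
move=> fi; have mf := measurable_int mu fi.
rewrite integralE [X in X @ _](_ : _ = (fun n =>
  \int[mu]_(w in F n) f^\+ w - \int[mu]_(w in F n) f^\- w)); last first.
  by apply/funext => n; rewrite integralE.
apply: cvgeB.
- apply: fin_num_adde_defl; rewrite fin_numN.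
  exact: integrable_neg_fin_num fi.
- by apply: ge0_cvg_integral_exhaustion => //; exact: measurable_funepos.
- by apply: ge0_cvg_integral_exhaustion => //; exact: measurable_funeneg.
Qed.

End exhaustion.

(** * Probability kernels and conditional distributions *)

Section kernels.
Context d d' (U : measurableType d) (V : measurableType d') (R : realType).
Variable k : {mfun U >-> pprobability V R}.

Lemma measurable_kernel_set C : measurable C ->
  measurable_fun setT (fun u => k u C).
Proof. exact: (measurable_kernel (kprobability (measurable_funPT k))). Qed.

Lemma measurable_integral_pkernel (h : U * V -> \bar R) :
  measurable_fun setT h -> (forall x, 0 <= h x) ->
  measurable_fun setT (fun u => \int[k u]_v h (u, v)).
Proof.
move=> mh h0.
exact: (measurable_fun_integral_finite_kernel h
  (kprobability (measurable_funPT k))).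
Qed.

End kernels.

(** Rectangles form a pi-system that generates the product sigma-algebra. *)
Lemma prod_measure_eq d d' (U : measurableType d) (V : measurableType d')
    (R : realType) (m1 m2 : {measure set (U * V) -> \bar R}) :
  m1 setT < +oo ->
  (forall B C, measurable B -> measurable C -> m1 (B `*` C) = m2 (B `*` C)) ->
  forall D, measurable D -> m1 D = m2 D.
Proof.
move=> m1oo m12; pose G := [set B `*` C | B in @measurable _ U & C in @measurable _ V].
apply: (measure_unique G (fun=> setT)) => //.
- by rewrite measurable_prod_measurableType.
- move=> _ _ [B1 mB1 [C1 mC1 <-]] [B2 mB2 [C2 mC2 <-]].
  exists (B1 `&` B2); first exact: measurableI.
  by exists (C1 `&` C2); [exact: measurableI|rewrite setXI].
- by move=> _; exists setT => //; exists setT => //; rewrite setXTT.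
- by rewrite bigcup_const.
- by move=> _ [B mB [C mC <-]]; exact: m12.
Qed.

Section joint_law.
Context d dU dV (R : realType) (W : measurableType d) (U : measurableType dU)
  (V : measurableType dV) (Pr : probability W R).
Variables (X : {mfun W >-> U}) (k : {mfun U >-> pprobability V R}).

Let step (w : W) : giry (U * V)%type R :=
  giry_prod (giry_ret (X w) : giry U R, (k (X w) : probability V R) : giry V R).

Let measurable_step : measurable_fun setT step.
Proof.
apply: measurableT_comp; first exact: measurable_giry_prod.
apply: measurable_fun_pair => /=.
  by apply: measurableT_comp => //; exact: measurable_giry_ret.
apply: measurable_giry_codensity => // B mB.
apply: (@measurableT_comp _ _ _ _ _ _ (fun u => k u B)) => //.
exact: measurable_kernel_set.
Qed.

(** The law on the product whose first marginal is the law of [X] and whose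
    conditional distribution of the second coordinate is [k]: the Giry bind of
    the products of the Dirac mass at [X w] with [k (X w)]. *)
Definition joint_law : subprobability (U * V)%type R :=
  giry_bind (Pr : giry W R) measurable_step.

Lemma integral_joint_law (h : U * V -> \bar R) :
  measurable_fun setT h -> (forall x, 0 <= h x) ->
  \int[joint_law]_x h x = \int[Pr]_w \int[k (X w)]_v h (X w, v).
Proof.
move=> mh h0.
rewrite [LHS](giry_int_bind _ measurable_step mh h0); apply: eq_integral => w _.
rewrite /giry_int /step /giry_prod /=.
rewrite [LHS]fubini_tonelli1//= integral_dirac//=; last first.
  exact: measurable_fun_fubini_tonelli_F.
by rewrite diracT mul1e.
Qed.

Lemma joint_lawX B C : measurable B -> measurable C ->
  joint_law (B `*` C) = \int[Pr]_(w in X @^-1` B) k (X w) C.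
Proof.
move=> mB mC; have mBC := measurableX mB mC.
transitivity (\int[joint_law]_x (\1_(B `*` C) x)%:E).
  by rewrite integral_indic ?setIT.
rewrite [LHS](giry_int_bind _ measurable_step); last 2 first.
- exact/measurable_EFinP/measurable_indic.
- by move=> x; rewrite lee_fin.
rewrite [RHS]integral_mkcond; apply: eq_integral => w _.
rewrite /giry_int integral_indic ?setIT//.
rewrite /step /giry_prod /= product_measure1E// patchE [X in X * _ = _]diracE.
have -> : (w \in X @^-1` B) = (X w \in B) by apply/idP/idP; rewrite !inE.
by case: ifP => _; rewrite ?mul1e ?mul0e.
Qed.

End joint_law.

Section conditioning.
Context d dU dV (R : realType) (W : measurableType d) (U : measurableType dU)
  (V : measurableType dV) (Pr : probability W R).

(** The law of [(X, Y)] and [joint_law] agree on rectangles by definition of a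
    conditional distribution, hence have the same integrals. *)
Lemma integral_conditional (X : {mfun W >-> U}) (Y : {mfun W >-> V})
    (k : {mfun U >-> pprobability V R}) (h : U * V -> \bar R) :
  conditional_distribution Pr X Y k ->
  measurable_fun setT h -> (forall x, 0 <= h x) ->
  \int[Pr]_w h (X w, Y w) = \int[Pr]_w \int[k (X w)]_v h (X w, v).
Proof.
move=> XYk mh h0; rewrite -integral_joint_law//.
transitivity (\int[distribution Pr (pairing X Y)]_x h x).
  by rewrite ge0_integral_distribution.
apply: eq_measure_integral => D mD _; move: D mD.
apply: prod_measure_eq; first exact: fin_num_fun_lty.
by move=> B C mB mC; rewrite [RHS]joint_lawX// -XYk.
Qed.

Lemma integral_conditional_in (X : {mfun W >-> U}) (Y : {mfun W >-> V})
    (k : {mfun U >-> pprobability V R}) (h : U * V -> \bar R) (B : set U) :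
  conditional_distribution Pr X Y k -> measurable B ->
  measurable_fun setT h -> (forall x, 0 <= h x) ->
  \int[Pr]_(w in X @^-1` B) h (X w, Y w) =
  \int[Pr]_(w in X @^-1` B) \int[k (X w)]_v h (X w, v).
Proof.
move=> XYk mB mh h0; have mB' : measurable (fst @^-1` B : set (U * V)).
  by rewrite -[X in measurable X]setTI; exact: measurable_fst.
rewrite [LHS]integral_mkcond [RHS]integral_mkcond.
transitivity (\int[Pr]_w (h \_ (fst @^-1` B)) (X w, Y w)).
  apply: eq_integral => w _; rewrite !patchE.
  by have -> : ((X w, Y w) \in fst @^-1` B) = (w \in X @^-1` B)
    by apply/idP/idP; rewrite !inE.
rewrite (integral_conditional XYk); last 2 first.
- exact/(measurable_restrictT h mB')/measurable_funTS.
- by move=> x; apply: erestrict_ge0.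
apply: eq_integral => w _; rewrite patchE; case: ifPn => [|] wB.
  apply: eq_integral => v _; rewrite patchE mem_set//=.
  by rewrite inE in wB.
rewrite integral0_eq// => v _; rewrite patchE memNset//=.
by rewrite notin_setE in wB.
Qed.

End conditioning.

Section conditional_independence.
Context d dT dU dV (R : realType) (W : measurableType d) (T : measurableType dT)
  (U : measurableType dU) (V : measurableType dV) (Pr : probability W R).

(** Given [S], the variable [X] brings no information on [Y], so that [kY S] is
    also the conditional distribution of [Y] given the pair [(S, X)]. For a
    fixed event on [Y], both sides are finite measures of the event on the
    pair; on rectangles, integrating out [X] with [kX] gives conditional
    independence. *)
Lemma conditional_distribution_pairing (S : {mfun W >-> T}) (X : {mfun W >-> U})
    (Y : {mfun W >-> V}) (kX : {mfun T >-> pprobability U R})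
    (kY : {mfun T >-> pprobability V R}) :
  conditional_distribution Pr S X kX ->
  conditionally_independent Pr S X Y kX kY ->
  conditional_distribution Pr (pairing S X) Y (kY \o fst).
Proof.
move=> SXk ind D C mD mC.
pose J := joint_law Pr (pairing S X) (kY \o fst).
have mTC : measurable ([set: T * U] `*` C) by exact: measurableX.
have mYC : measurable (Y @^-1` C).
  by rewrite -[X in measurable X]setTI; exact: measurable_funPT.
(* For fixed [C], both sides of the goal as measures of [D]. *)
have mSX : measurable_fun setT (pairing S X) by exact: measurable_funPT.
pose m1 : {measure set (T * U) -> \bar R} :=
  pushforward (mrestr Pr mYC) (pairing S X).
pose m2 : {measure set (T * U) -> \bar R} :=
  pushforward (mrestr J mTC) fst.
have m2E D' : measurable D' -> m2 measurable_fst D' =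
    \int[Pr]_(w in pairing S X @^-1` D') kY (S w) C.
  move=> mD'; rewrite -[RHS](joint_lawX Pr (pairing S X) (kY \o fst) mD' mC).
  congr (J _); apply/seteqP; split => -[[t u] v] /=; by [case => ? []|case].
rewrite -[RHS]m2E// -[LHS]/(m1 mSX D); move: D mD.
apply: prod_measure_eq.
  rewrite -[X in X < _]/(Pr (setT `&` Y @^-1` C)) setTI.
  by rewrite (le_lt_trans (probability_le1 Pr mYC))// ltry.
move=> A B mA mB; rewrite m2E; last exact: measurableX.
transitivity (Pr (S @^-1` A `&` (X @^-1` B `&` Y @^-1` C))).
  by rewrite setIA.
rewrite ind//; pose h (tu : T * U) := kY tu.1 C * (\1_B tu.2)%:E.
transitivity (\int[Pr]_(w in S @^-1` A) h (S w, X w)).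
  rewrite (integral_conditional_in SXk mA); last 2 first.
  - apply: emeasurable_funM.
      apply: (@measurableT_comp _ _ _ _ _ _ (fun t => kY t C)) => //.
      exact: measurable_kernel_set.
    apply/measurable_EFinP; apply: measurableT_comp => //.
  - by move=> x; rewrite mule_ge0// lee_fin.
  apply: eq_integral => w _; rewrite /h/= ge0_integralZl//.
  - by rewrite integral_indic// setIT muleC.
  - exact/measurable_EFinP.
rewrite -[RHS]/(\int[Pr]_(w in S @^-1` A `&` X @^-1` B) kY (S w) C).
rewrite [RHS]integral_mkcondr; apply: eq_integral => w _.
rewrite patchE /h/= indicE.
have -> : (w \in X @^-1` B) = (X w \in B) by apply/idP/idP; rewrite !inE.
by case: ifP => _; rewrite ?mule1 ?mule0.
Qed.

End conditional_independence.

(** * Bayes acts *)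

Section mfun_if.
Context d d' (U : measurableType d) (V : measurableType d').
Variables (B : set U) (mB : measurable B) (f g : {mfun U >-> V}).

(** The measurability of [B] is an argument so that the measurable function
    structure can be found from the term alone. *)
Definition mfun_if of measurable B := fun u => if u \in B then f u else g u.

Let measurable_mfun_if : measurable_fun setT (mfun_if mB).
Proof.
apply: measurable_fun_ifT => //.
apply: (measurable_fun_bool true); rewrite setTI.
rewrite [X in measurable X](_ : _ = B)//; apply/seteqP; split => u /= uB.
  exact: set_mem uB.
exact: mem_set uB.
Qed.

HB.instance Definition _ :=
  isMeasurableFun.Build _ _ U V (mfun_if mB) measurable_mfun_if.

End mfun_if.

Section bayes_acts.
Context (R : realType) dZ (Z : measurableType dZ) dA (A : measurableType dA).
Variables (L : Z -> A -> \bar R) (act : pprobability Z R -> A)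
  (PP : set (pprobability Z R)).
Hypothesis L_dom : has_domain L act PP.

(** The expected loss as a difference of two nonnegative expectations: these
    can be disintegrated and compared without any integrability assumption. *)
Definition gross_loss (P : pprobability Z R) a : \bar R :=
  \int[P]_z (L ^~ a)^\+ z.
Definition gross_gain (P : pprobability Z R) a : \bar R :=
  \int[P]_z (L ^~ a)^\- z.

Lemma gross_loss_ge0 P a : 0 <= gross_loss P a.
Proof. by apply: integral_ge0. Qed.

Lemma gross_gain_ge0 P a : 0 <= gross_gain P a.
Proof. by apply: integral_ge0. Qed.

Lemma uncertainty_le_expected_loss P a :
  uncertainty L P <= expected_loss L P a.
Proof. by apply: ereal_inf_lbound; exists a. Qed.

Lemma uncertainty_fin_num P : PP P -> uncertainty L P \is a fin_num.
Proof. by move=> /L_dom[]. Qed.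

(** If the expected gain were infinite, the expected loss, which exists, would
    be -oo and so would the uncertainty. *)
Lemma gross_gain_fin_num P a : PP P -> gross_gain P a \is a fin_num.
Proof.
move=> /L_dom[/(_ a) ex Hfin _]; have := uncertainty_le_expected_loss P a.
have := gross_gain_ge0 P a; move: Hfin ex.
rewrite /expected_loss integralE /expectation_exists -/(gross_loss P a).
rewrite -/(gross_gain P a).
by case: (uncertainty L P) => // h; case: (gross_gain P a) => //;
  case: (gross_loss P a).
Qed.

Lemma uncertainty_gain_le_loss P a : PP P ->
  uncertainty L P + gross_gain P a <= gross_loss P a.
Proof.
move=> PPP; have := uncertainty_le_expected_loss P a.
by rewrite /expected_loss integralE leeBrDr// gross_gain_fin_num.
Qed.

Lemma uncertainty_bayes P : PP P ->
  uncertainty L P = gross_loss P (act P) - gross_gain P (act P).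
Proof. by move=> /L_dom[_ _ <-]; rewrite /expected_loss integralE. Qed.

Lemma gross_loss_bayes_fin_num P : PP P -> gross_loss P (act P) \is a fin_num.
Proof.
move=> PPP; have := gross_gain_fin_num (act P) PPP.
have := uncertainty_fin_num PPP; rewrite uncertainty_bayes//.
by case: gross_gain => //; case: gross_loss.
Qed.

Lemma eq_uncertainty (P Q : pprobability Z R) :
  (forall C, measurable C -> P C = Q C) -> uncertainty L P = uncertainty L Q.
Proof.
move=> PQ; congr ereal_inf; apply/seteqP; split => _ [a _ <-]; exists a => //.
  by apply: eq_measure_integral => C mC _; exact/esym/PQ.
by apply: eq_measure_integral => C mC _; exact: PQ.
Qed.

End bayes_acts.

Section bayes_rule.
Context (R : realType) dZ (Z : measurableType dZ) dA (A : measurableType dA).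
Variables (act : pprobability Z R -> A) (PP : set (pprobability Z R)).
Context dU (U : measurableType dU) (k : {mfun U >-> pprobability Z R}).
Hypotheses (act_meas : measurable_selection act PP) (kPP : forall u, PP (k u)).

(** The Bayes act against [k u]; as in [mfun_if], the proofs that make this map
    measurable are arguments. *)
Definition bayes_rule of measurable_selection act PP & (forall u, PP (k u)) :=
  fun u => act (k u).

Let measurable_bayes_rule : measurable_fun setT (bayes_rule act_meas kPP).
Proof.
move=> _ B mB; have [V mV VE] := act_meas mB.
rewrite setTI [X in measurable X](_ : _ = k @^-1` V).
  by rewrite -[X in measurable X]setTI; exact: measurable_funPT.
apply/seteqP; split => u /= h.
  by have [] : (PP `&` V) (k u) by rewrite -VE.
by have [] : (PP `&` act @^-1` B) (k u) by rewrite VE.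
Qed.

HB.instance Definition _ := isMeasurableFun.Build _ _ U A
  (bayes_rule act_meas kPP) measurable_bayes_rule.

End bayes_rule.

Section patched_kernel.
Context (R : realType) dZ (Z : measurableType dZ) dU (U : measurableType dU).
Variables (mu : {measure set U -> \bar R}) (PP : set (pprobability Z R)).

(** The kernel is replaced by a constant member of the family on a measurable
    null set outside of which it takes its values in the family. *)
Lemma ae_patched_kernel (k : {mfun U >-> pprobability Z R})
    (P0 : pprobability Z R) : PP P0 -> {ae mu, forall u, PP (k u)} ->
  exists (k' : {mfun U >-> pprobability Z R}) (N : set U),
    [/\ measurable N, mu N = 0, forall u, PP (k' u) &
        forall u, ~ N u -> k' u = k u].
Proof.
move=> PP0 [N [mN N0 kN]]; exists (mfun_if (cst P0) k mN), N; split => //.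
  move=> u; rewrite /= /mfun_if; case: ifPn => //; rewrite notin_setE => Nu.
  by apply: contrapT => nPP; exact/Nu/kN.
by move=> u Nu; rewrite /= /mfun_if memNset.
Qed.

End patched_kernel.

(** * The risk of a decision rule *)

(** The inequality [x + y <= z] with [x] split into its positive and negative
    parts: if [y] and [z] are nonnegative, so are all terms. *)
Lemma le_shift_neg_part (R : realDomainType) (x y z : \bar R) :
  x \is a fin_num -> x + y <= z -> y + maxe x 0 <= z + maxe (- x) 0.
Proof.
move=> xfin xyz; have [x0|/ltW x0] := leP 0 x.
  by rewrite (max_idPr _) ?oppe_le0// adde0 addeC.
by rewrite (max_idPl _) ?oppe_ge0// adde0 leeBrDr// addeC.
Qed.

Section gross_risks.
Context (R : realType) dZ (Z : measurableType dZ) dA (A : measurableType dA).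
Variable L : Z -> A -> \bar R.
Hypothesis L_meas : measurable_fun [set: Z * A] (fun za => L za.1 za.2).
Context dU (U : measurableType dU).
Variables (k : {mfun U >-> pprobability Z R}) (delta : {mfun U >-> A}).

Lemma measurable_rule_loss :
  measurable_fun [set: U * Z] (fun uz => L uz.2 (delta uz.1)).
Proof.
apply: (@measurableT_comp _ _ _ _ _ _ (fun za : Z * A => L za.1 za.2) _
  (fun uz : U * Z => (uz.2, delta uz.1))) => //.
by apply: measurable_fun_pair => //=; exact: measurableT_comp.
Qed.

Let loss (uz : U * Z) := L uz.2 (delta uz.1).

Let gross_lossE u : gross_loss L (k u) (delta u) = \int[k u]_z loss^\+ (u, z).
Proof. by apply: eq_integral => z _; rewrite !funeposE. Qed.

Let gross_gainE u : gross_gain L (k u) (delta u) = \int[k u]_z loss^\- (u, z).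
Proof. by apply: eq_integral => z _; rewrite !funenegE. Qed.

Lemma measurable_gross_loss :
  measurable_fun setT (fun u => gross_loss L (k u) (delta u)).
Proof.
rewrite (funext gross_lossE); apply: measurable_integral_pkernel => //.
by apply: measurable_funepos; exact: measurable_rule_loss.
Qed.

Lemma measurable_gross_gain :
  measurable_fun setT (fun u => gross_gain L (k u) (delta u)).
Proof.
rewrite (funext gross_gainE); apply: measurable_integral_pkernel => //.
by apply: measurable_funeneg; exact: measurable_rule_loss.
Qed.

Context dW (W : measurableType dW) (P : probability W R) (Y : {mfun W >-> U})
  (X : {mfun W >-> Z}).
Hypothesis YXk : conditional_distribution P Y X k.

Lemma integral_gross_loss B : measurable B ->
  \int[P]_(w in Y @^-1` B) (fun w => L (X w) (delta (Y w)))^\+ w =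
  \int[P]_(w in Y @^-1` B) gross_loss L (k (Y w)) (delta (Y w)).
Proof.
move=> mB; transitivity (\int[P]_(w in Y @^-1` B) loss^\+ (Y w, X w)).
  by apply: eq_integral => w _; rewrite !funeposE.
rewrite (integral_conditional_in (h := loss^\+) YXk mB).
- by apply: eq_integral => w _; rewrite gross_lossE.
- by apply: measurable_funepos; exact: measurable_rule_loss.
- by move=> uz; exact: funepos_ge0.
Qed.

Lemma integral_gross_gain B : measurable B ->
  \int[P]_(w in Y @^-1` B) (fun w => L (X w) (delta (Y w)))^\- w =
  \int[P]_(w in Y @^-1` B) gross_gain L (k (Y w)) (delta (Y w)).
Proof.
move=> mB; transitivity (\int[P]_(w in Y @^-1` B) loss^\- (Y w, X w)).
  by apply: eq_integral => w _; rewrite !funenegE.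
rewrite (integral_conditional_in (h := loss^\-) YXk mB).
- by apply: eq_integral => w _; rewrite gross_gainE.
- by apply: measurable_funeneg; exact: measurable_rule_loss.
- by move=> uz; exact: funeneg_ge0.
Qed.

End gross_risks.

Section bayes_risk.
Context (R : realType) dZ (Z : measurableType dZ) dA (A : measurableType dA).
Variables (L : Z -> A -> \bar R) (act : pprobability Z R -> A)
  (PP : set (pprobability Z R)).
Hypotheses (L_meas : measurable_fun [set: Z * A] (fun za => L za.1 za.2))
  (PP_convex : convex_family PP) (L_dom : has_domain L act PP)
  (act_meas : measurable_selection act PP).
Context dW (W : measurableType dW) (P : probability W R) dU
  (U : measurableType dU) (Y : {mfun W >-> U}) (X : {mfun W >-> Z})
  (k : {mfun U >-> pprobability Z R}).
Hypotheses (YXk : conditional_distribution P Y X k) (kPP : forall u, PP (k u)).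

(** The uncertainty is an infimum over a possibly uncountable set, but it is
    attained by the measurable Bayes rule. *)
Lemma measurable_uncertainty :
  measurable_fun setT (fun u => uncertainty L (k u)).
Proof.
rewrite (_ : (fun _ => _) = (fun u => gross_loss L (k u) (bayes_rule act_meas kPP u) -
  gross_gain L (k u) (bayes_rule act_meas kPP u))); last first.
  by apply/funext => u; rewrite (uncertainty_bayes L_dom (kPP u)).
apply: emeasurable_funB.
  exact: (measurable_gross_loss L_meas k (bayes_rule act_meas kPP)).
exact: (measurable_gross_gain L_meas k (bayes_rule act_meas kPP)).
Qed.

Hypothesis H_int : P.-integrable setT (fun w => uncertainty L (k (Y w))).

(** Conditionally on the observation, a rule costs at least the uncertainty of
    the predictive distribution. Integrating this with every negative term
    moved to the other side only involves nonnegative functions, and the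
    existence of the expected loss is used at the very end, to subtract. *)
Lemma uncertainty_le_risk (delta : {mfun U >-> A}) :
  expectation_exists P (fun w => L (X w) (delta (Y w))) ->
  \int[P]_w uncertainty L (k (Y w)) <= \int[P]_w L (X w) (delta (Y w)).
Proof.
rewrite /expectation_exists [leRHS]integralE.
rewrite -(preimage_setT Y) (integral_gross_loss L_meas delta YXk)//.
rewrite (integral_gross_gain L_meas delta YXk)// preimage_setT.
set p := \int[P]_w gross_loss _ _ _; set n := \int[P]_w gross_gain _ _ _ => ex.
have p0 : 0 <= p by apply: integral_ge0 => w _; exact: gross_loss_ge0.
have n0 : 0 <= n by apply: integral_ge0 => w _; exact: gross_gain_ge0.
pose H w := uncertainty L (k (Y w)).
have mH : measurable_fun setT H := measurable_int P H_int.
have mp : measurable_fun setT (fun w => gross_loss L (k (Y w)) (delta (Y w))).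
  exact: measurableT_comp (measurable_gross_loss L_meas k delta) _.
have mn : measurable_fun setT (fun w => gross_gain L (k (Y w)) (delta (Y w))).
  exact: measurableT_comp (measurable_gross_gain L_meas k delta) _.
have mHp := measurable_funepos mH; have mHn := measurable_funeneg mH.
have gl0 w : 0 <= gross_loss L (k (Y w)) (delta (Y w)) := gross_loss_ge0 _ _ _.
have gg0 w : 0 <= gross_gain L (k (Y w)) (delta (Y w)) := gross_gain_ge0 _ _ _.
have : n + \int[P]_w H^\+ w <= p + \int[P]_w H^\- w.
  rewrite -(ge0_integralD P measurableT _ mn _ mHp)//.
  rewrite -(ge0_integralD P measurableT _ mp _ mHn)//; apply: ge0_le_integral => //.
  - by move=> w _; rewrite adde_ge0.
  - exact: emeasurable_funD.
  - exact: emeasurable_funD.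
  move=> w _.
  have := uncertainty_gain_le_loss L_dom (delta (Y w)) (kPP (Y w)).
  have := uncertainty_fin_num L_dom (kPP (Y w)).
  by rewrite -/(H w) funeposE funenegE; exact: le_shift_neg_part.
rewrite -/H (integralE _ _ H).
move: (integrable_pos_fin_num measurableT H_int) ex p0 n0.
move: (integrable_neg_fin_num measurableT H_int).
rewrite -/H.
case: p => [p| |]//; case: n => [n| |]//;
  case: (\int[P]_w H^\+ w) => [hp| |]//; case: (\int[P]_w H^\- w) => [hn| |]//;
  rewrite ?leey//=.
rewrite -!EFinD !lee_fin => _ _ _ _ _ ?; lra.
Qed.

End bayes_risk.

(** * Truncated Bayes rules *)

Lemma integrable_pos_neg d (W : measurableType d) (R : realType)
    (mu : {measure set W -> \bar R}) (D : set W) (f : W -> \bar R) :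
  measurable D -> measurable_fun D f ->
  \int[mu]_(w in D) f^\+ w < +oo -> \int[mu]_(w in D) f^\- w < +oo ->
  mu.-integrable D f.
Proof.
move=> mD mf fp fn; apply/integrableP; split => //.
rewrite -[fun x => _]/(abse \o f) fune_abse ge0_integralD//.
- exact: lte_add_pinfty.
- exact: measurable_funepos.
- exact: measurable_funeneg.
Qed.

Section truncated_bayes_rules.
Context (R : realType) dZ (Z : measurableType dZ) dA (A : measurableType dA).
Variables (L : Z -> A -> \bar R) (act : pprobability Z R -> A)
  (PP : set (pprobability Z R)).
Hypotheses (L_meas : measurable_fun [set: Z * A] (fun za => L za.1 za.2))
  (PP_convex : convex_family PP) (L_dom : has_domain L act PP)
  (act_meas : measurable_selection act PP).
Context dW (W : measurableType dW) (P : probability W R) dU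
  (U : measurableType dU) (Y : {mfun W >-> U}) (X : {mfun W >-> Z})
  (k : {mfun U >-> pprobability Z R}).
Hypotheses (YXk : conditional_distribution P Y X k) (kPP : forall u, PP (k u)).

(** Observations after which the Bayes act has bounded expected gain and
    loss. *)
Definition tame n : set U :=
  [set u | gross_loss L (k u) (act (k u)) <= n%:R%:E] `&`
  [set u | gross_gain L (k u) (act (k u)) <= n%:R%:E].

Lemma measurable_tame n : measurable (tame n).
Proof.
apply: measurableI; rewrite -[X in measurable X]setTI;
  apply: emeasurable_fun_infty_c => //.
- exact: (measurable_gross_loss L_meas k (bayes_rule act_meas kPP)).
- exact: (measurable_gross_gain L_meas k (bayes_rule act_meas kPP)).
Qed.

Lemma nondecreasing_tame : nondecreasing_seq tame.
Proof.
move=> m n mn; apply/subsetPset => u [pm gm]; split => /=.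
  by rewrite (le_trans pm)// lee_fin ler_nat.
by rewrite (le_trans gm)// lee_fin ler_nat.
Qed.

Lemma bigcup_tame : \bigcup_n tame n = setT.
Proof.
apply/seteqP; split => // u _.
have := gross_loss_bayes_fin_num L_dom (kPP u).
have := gross_gain_fin_num L_dom (act (k u)) (kPP u).
move=> /fineK gE /fineK pE.
set p := gross_loss _ _ _ in pE *; set g := gross_gain _ _ _ in gE *.
exists (maxn (Num.truncn (fine p)).+1 (Num.truncn (fine g)).+1) => //.
split => /=.
  rewrite -/p -pE lee_fin (le_trans (ltW (truncnS_gt _)))//.
  by rewrite ler_nat leq_maxl.
rewrite -/g -gE lee_fin (le_trans (ltW (truncnS_gt _)))//.
by rewrite ler_nat leq_maxr.
Qed.

(** The law of [X] is the mean of [k Y], hence in the convex family. *)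
Lemma marginal_in_family (Q : pprobability Z R) :
  (forall C, measurable C -> Q C = P (X @^-1` C)) -> PP Q.
Proof.
move=> QE; apply: (PP_convex (mu := P) (k := k \o Y)) => [w|C mC].
  exact: kPP.
by rewrite QE// -[X in P X]setTI -(preimage_setT Y) YXk// preimage_setT.
Qed.

Let law : pprobability Z R := (distribution P X : probability Z R).

Let PPlaw : PP law. Proof. by apply: marginal_in_family. Qed.

Lemma integrable_marginal_bayes_loss :
  P.-integrable setT (fun w => L (X w) (act law)).
Proof.
have mL : measurable_fun setT (L ^~ (act law)).
  exact: (measurable_fun_pair1 (act law) L_meas).
apply: integrable_pos_neg => //.
- exact: measurableT_comp mL (measurable_funPT X).
- rewrite (_ : integral _ _ _ = gross_loss L law (act law)).
    by rewrite ltey_eq (gross_loss_bayes_fin_num L_dom).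
  rewrite /gross_loss ge0_integral_distribution//.
  + by apply: eq_integral => w _; rewrite /= !funeposE.
  + exact: measurable_funepos.
- rewrite (_ : integral _ _ _ = gross_gain L law (act law)).
    by rewrite ltey_eq (gross_gain_fin_num L_dom).
  rewrite /gross_gain ge0_integral_distribution//.
  + by apply: eq_integral => w _; rewrite /= !funenegE.
  + exact: measurable_funeneg.
Qed.

(** Outside [tame n] the observation is ignored: the Bayes act against the
    marginal law of [X] is used. This law belongs to the family because the
    family is convex. *)
Definition truncated_kernel n : {mfun U >-> pprobability Z R} :=
  mfun_if k (cst law) (measurable_tame n).

Lemma truncated_kernel_in n u : PP (truncated_kernel n u).
Proof. by rewrite /truncated_kernel /= /mfun_if; case: ifP. Qed.

Let f w := L (X w) (act (k (Y w))).
Let g w := L (X w) (act law).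
Let F n := Y @^-1` (tame n).
Let mF n : measurable (F n).
Proof.
rewrite -[X in measurable X]setTI; apply: measurable_funPT => //.
exact: measurable_tame.
Qed.

Let mf : measurable_fun setT f.
Proof.
exact: measurableT_comp (measurable_rule_loss L_meas (bayes_rule act_meas kPP))
  (measurable_funPT (pairing Y X)).
Qed.

(** On the tame event the loss of the Bayes rule is integrable, which may fail on
    the whole space even if the uncertainty is integrable: gains and losses
    that cancel conditionally on the observation can both have infinite
    expectation. *)
Lemma bayes_loss_tame n : P.-integrable (F n) f /\
  \int[P]_(w in F n) f w =
  \int[P]_(w in F n) uncertainty L (k (Y w)).
Proof.
have fp := integral_gross_loss L_meas (bayes_rule act_meas kPP) YXk
  (measurable_tame n).
have fn := integral_gross_gain L_meas (bayes_rule act_meas kPP) YXk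
  (measurable_tame n).
pose p u := gross_loss L (k u) (act (k u)).
pose q u := gross_gain L (k u) (act (k u)).
have p0 u : 0 <= p u := gross_loss_ge0 _ _ _.
have q0 u : 0 <= q u := gross_gain_ge0 _ _ _.
have mp : measurable_fun setT (p \o Y).
  exact: measurableT_comp (measurable_gross_loss L_meas k (bayes_rule act_meas kPP)) _.
have mq : measurable_fun setT (q \o Y).
  exact: measurableT_comp (measurable_gross_gain L_meas k (bayes_rule act_meas kPP)) _.
have bounded h : (forall w, F n w -> 0 <= h (Y w)) ->
    measurable_fun setT (h \o Y) ->
    (forall w, F n w -> h (Y w) <= n%:R%:E) -> P.-integrable (F n) (h \o Y).
  move=> h0 mh hn; apply: (@le_integrable _ _ _ _ _ (mF n) _ (cst n%:R%:E)).
  - exact: measurable_funTS.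
  - by move=> w Fw /=; rewrite gee0_abs ?h0// ger0_norm// hn.
  - exact: finite_measure_integrable_cst.
have ip : P.-integrable (F n) (p \o Y) by apply: bounded => // w [].
have iq : P.-integrable (F n) (q \o Y) by apply: bounded => // w [].
split.
  apply: integrable_pos_neg => //; first exact: measurable_funTS.
  + rewrite fp; exact: integrable_lty ip.
  + rewrite fn; exact: integrable_lty iq.
rewrite integralE fp fn -[LHS](integralB (mF n) ip iq); apply: eq_integral => w _.
by rewrite (uncertainty_bayes L_dom (kPP (Y w))).
Qed.

(** The loss is that of the Bayes rule on the tame event and that of a constant
    act with integrable loss outside. *)
Lemma truncated_bayes_risk n :
  let loss w := score L act (X w) (truncated_kernel n (Y w)) in
  [/\ P.-integrable setT loss &
  \int[P]_w loss w = \int[P]_(w in Y @^-1` tame n) uncertainty L (k (Y w)) +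
    (\int[P]_w g w - \int[P]_(w in Y @^-1` tame n) g w)].
Proof.
move=> loss; have [fi fE] := bayes_loss_tame n.
have gi : P.-integrable setT g := integrable_marginal_bayes_loss.
have lossE : loss = (f \_ (F n)) \+ (g \_ (~` F n)).
  apply/funext => w; rewrite /loss /score /= /truncated_kernel /mfun_if.
  case: ifPn => [/set_mem|/negP] uF.
    by rewrite !patchE mem_set// memNset ?adde0//; exact.
  by rewrite !patchE memNset ?mem_set ?add0e//= => Fw; apply: uF; rewrite inE.
have mCF : measurable (~` F n) := measurableC (mF n).
have fi' : P.-integrable setT (f \_ (F n)).
  exact: (integrable_mkcond _ (mF n)).1.
have gi' : P.-integrable setT (g \_ (~` F n)).
  apply: (integrable_mkcond _ mCF).1; exact: integrableS gi.
split; first by rewrite lossE; exact: integrableD.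
rewrite lossE integralD// -!integral_mkcond fE; congr (_ + _).
rewrite -[X in \int[P]_(w in X) g w - _](setUv (F n)) integral_setU//.
- rewrite addeAC subee ?add0e//.
  by apply: integrable_fin_num => //; exact: integrableS gi.
- by rewrite setUv; exact: measurable_int gi.
- by apply/disj_setPCl.
Qed.

End truncated_bayes_rules.

(** * Minimal risks *)

Section minimal_risks.
Context (R : realType) dZ (Z : measurableType dZ) dA (A : measurableType dA).
Variables (L : Z -> A -> \bar R) (act : pprobability Z R -> A)
  (PP : set (pprobability Z R)).
Hypotheses (L_meas : measurable_fun [set: Z * A] (fun za => L za.1 za.2))
  (PP_convex : convex_family PP) (L_dom : has_domain L act PP)
  (act_meas : measurable_selection act PP).
Context dW (W : measurableType dW) (P : probability W R) dU
  (U : measurableType dU) (Y : {mfun W >-> U}) (X : {mfun W >-> Z})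
  (k : {mfun U >-> pprobability Z R}).
Hypotheses (YXk : conditional_distribution P Y X k) (kPP : forall u, PP (k u))
  (H_int : P.-integrable setT (fun w => uncertainty L (k (Y w)))).

Let F n := Y @^-1` (tame L act k n).

Let mF n : measurable (F n).
Proof.
rewrite -[X in measurable X]setTI; apply: measurable_funPT => //.
exact: (measurable_tame L_meas act_meas kPP).
Qed.

Let ndF : nondecreasing_seq F.
Proof.
move=> m n /(nondecreasing_tame L act k)/subsetPset mn; apply/subsetPset => w.
exact: mn.
Qed.

Let covF : \bigcup_n F n = setT.
Proof. by rewrite -preimage_bigcup (bigcup_tame L_dom kPP) preimage_setT. Qed.

(** The risks of the truncated Bayes rules converge to the expected uncertainty,
    which is a lower bound by [uncertainty_le_risk]. *)
Let ereal_inf_risks (V : set (\bar R)) :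
  (forall v, V v -> \int[P]_w uncertainty L (k (Y w)) <= v) ->
  (forall n, V (\int[P]_w score L act (X w)
    (truncated_kernel L_meas act_meas P X kPP n (Y w)))) ->
  ereal_inf V = \int[P]_w uncertainty L (k (Y w)).
Proof.
move=> lbV trV; apply/eqP; rewrite eq_le; apply/andP; split; last first.
  exact: le_ereal_inf_tmp.
have gi := integrable_marginal_bayes_loss L_meas PP_convex L_dom YXk kPP.
have gfin := integrable_fin_num measurableT gi.
set g := (X in P.-integrable _ X) in gi gfin.
have cv : (\int[P]_(w in F n) uncertainty L (k (Y w)) +
    (\int[P]_w g w - \int[P]_(w in F n) g w)) @[n --> \oo] -->
    \int[P]_w uncertainty L (k (Y w)).
  have cg := cvg_integral_exhaustion mF ndF covF gi.
  have c0 : (\int[P]_w g w - \int[P]_(w in F n) g w) @[n --> \oo] --> 0.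
    rewrite -(subee gfin); apply: (cvgeB _ _ cg); last exact: cvg_cst.
    exact: fin_num_adde_defr.
  have := cvgeD _ (cvg_integral_exhaustion mF ndF covF H_int) c0.
  by rewrite adde0; apply; exact: fin_num_adde_defl.
apply: (cvge_ge _ cv); apply: nearW => n; apply: ereal_inf_lbound.
have [_ <-] := truncated_bayes_risk L_meas PP_convex L_dom act_meas YXk kPP n.
exact: trV.
Qed.

Lemma ereal_inf_loss :
  ereal_inf [set \int[P]_w L (X w) (delta (Y w)) |
    delta in [set delta : {mfun U >-> A} |
      expectation_exists P (fun w => L (X w) (delta (Y w)))]] =
  \int[P]_w uncertainty L (k (Y w)).
Proof.
apply: ereal_inf_risks => [_ [delta ex <-]|n].
  exact: (uncertainty_le_risk L_meas L_dom YXk kPP H_int).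
have [fi _] := truncated_bayes_risk L_meas PP_convex L_dom act_meas YXk kPP n.
have trPP := truncated_kernel_in L_meas PP_convex act_meas YXk kPP n.
by exists (bayes_rule act_meas trPP); [exact: integrable_add_def|].
Qed.

(** A rule that reports a distribution acts through its Bayes act, and the
    truncated Bayes rules are of this form. *)
Lemma ereal_inf_score :
  ereal_inf [set \int[P]_w score L act (X w) (delta (Y w)) |
    delta in [set delta : {mfun U >-> pprobability Z R} |
      (forall y, PP (delta y)) /\
      expectation_exists P (fun w => score L act (X w) (delta (Y w)))]] =
  \int[P]_w uncertainty L (k (Y w)).
Proof.
apply: ereal_inf_risks => [_ [delta [dPP ex] <-]|n].
  exact: (uncertainty_le_risk L_meas L_dom YXk kPP H_int
    (delta := bayes_rule act_meas dPP)).
have [fi _] := truncated_bayes_risk L_meas PP_convex L_dom act_meas YXk kPP n.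
have trPP := truncated_kernel_in L_meas PP_convex act_meas YXk kPP n.
eexists; last reflexivity.
by split; [exact: trPP|exact: integrable_add_def].
Qed.

(** * Discrepancy between sampling and predictive distributions *)

Section discrepancy.
Context dT (T : measurableType dT) (S : {mfun W >-> T})
  (PZ : {mfun T >-> pprobability Z R}).
Hypotheses (PZ_in : forall t, PP (PZ t))
  (SYX : conditional_distribution P (pairing S Y) X (PZ \o fst))
  (HZ_int : P.-integrable setT (fun w => uncertainty L (PZ (S w)))).

Let b : {mfun (T * U)%type >-> A} := bayes_rule act_meas kPP \o snd.

Let p w := gross_loss L (PZ (S w)) (act (k (Y w))).
Let q w := gross_gain L (PZ (S w)) (act (k (Y w))).
Let D w := discrepancy L act (PZ (S w)) (k (Y w)).

Let DE w : D w = p w - q w - uncertainty L (PZ (S w)).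
Proof. by rewrite /D /discrepancy /expected_score integralE. Qed.

Let D0 w : 0 <= D w.
Proof.
rewrite /D /discrepancy sube_ge0; first exact: uncertainty_le_expected_loss.
by rewrite (uncertainty_fin_num L_dom).
Qed.

Let mp : measurable_fun setT p.
Proof.
exact: measurableT_comp (measurable_gross_loss L_meas (PZ \o fst) b)
  (measurable_funPT (pairing S Y)).
Qed.

Let mq : measurable_fun setT q.
Proof.
exact: measurableT_comp (measurable_gross_gain L_meas (PZ \o fst) b)
  (measurable_funPT (pairing S Y)).
Qed.

Let mD : measurable_fun setT D.
Proof.
rewrite (funext DE); apply: emeasurable_funB; last exact: measurable_int HZ_int.
exact: emeasurable_funB.
Qed.

(** Given [(S, Y)], the variable [X] has law [PZ S]; given [Y], it has law [k Y].
    Hence [p - q] and the expected loss of the Bayes act under [k Y] both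
    average, on a tame event, to the expected loss of the Bayes rule. *)
Let integral_discrepancy_tame n :
  \int[P]_(w in F n) D w =
  \int[P]_(w in F n) (uncertainty L (k (Y w)) - uncertainty L (PZ (S w))).
Proof.
have [fi fE] := bayes_loss_tame L_meas L_dom act_meas YXk kPP n.
set f := (X in P.-integrable _ X) in fi fE.
have mB : measurable (snd @^-1` tame L act k n : set (T * U)).
  rewrite -[X in measurable X]setTI; apply: measurable_snd => //.
  exact: (measurable_tame L_meas act_meas kPP).
have fp : \int[P]_(w in F n) f^\+ w = \int[P]_(w in F n) p w.
  exact: (integral_gross_loss L_meas b SYX mB).
have fq : \int[P]_(w in F n) f^\- w = \int[P]_(w in F n) q w.
  exact: (integral_gross_gain L_meas b SYX mB).
have ip : P.-integrable (F n) p.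
  apply/integrableP; split; first exact: measurable_funTS.
  under eq_integral do rewrite gee0_abs ?gross_loss_ge0//.
  rewrite -fp; exact: (integral_funepos_lt_pinfty (mF n) fi).
have iq : P.-integrable (F n) q.
  apply/integrableP; split; first exact: measurable_funTS.
  under eq_integral do rewrite gee0_abs ?gross_gain_ge0//.
  rewrite -fq; exact: (integral_funeneg_lt_pinfty (mF n) fi).
have iHZ : P.-integrable (F n) (fun w => uncertainty L (PZ (S w))).
  exact: integrableS HZ_int.
have iH : P.-integrable (F n) (fun w => uncertainty L (k (Y w))).
  exact: integrableS H_int.
rewrite [RHS](integralB (mF n) iH iHZ) -fE.
rewrite (funext DE) (integralB (mF n) (integrableB (mF n) ip iq) iHZ).
by rewrite (integralB (mF n) ip iq) -fp -fq -integralE.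
Qed.

(** Both sides are integrated over tame events: the discrepancy is nonnegative
    and the difference of uncertainties is integrable, so both integrals are
    limits along the exhaustion. *)
Lemma integral_discrepancy :
  \int[P]_w discrepancy L act (PZ (S w)) (k (Y w)) =
  \int[P]_w uncertainty L (k (Y w)) - \int[P]_w uncertainty L (PZ (S w)).
Proof.
rewrite -(integralB measurableT H_int HZ_int).
have cD := ge0_cvg_integral_exhaustion mF ndF covF mD D0 (mu := P).
have cH := cvg_integral_exhaustion mF ndF covF
  (integrableB measurableT H_int HZ_int).
rewrite (funext integral_discrepancy_tame) in cD.
exact: (cvg_unique _ cD cH).
Qed.

End discrepancy.
End minimal_risks.

(** * Criteria for experimental designs *)

Section experiments.
Context (R : realType) dZ (Z : measurableType dZ) dT (T : measurableType dT)
  dA (A : measurableType dA) (L : Z -> A -> \bar R)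
  (act : pprobability Z R -> A) (PP : set (pprobability Z R))
  (Pi : probability T R) (PZ : {mfun T >-> pprobability Z R}).
Hypotheses (L_meas : measurable_fun [set: Z * A] (fun za => L za.1 za.2))
  (PP_convex : convex_family PP) (L_dom : has_domain L act PP)
  (act_meas : measurable_selection act PP) (PZ_in : forall t, PP (PZ t)).
Hypothesis HZ_int : Pi.-integrable [set: T] (fun t => uncertainty L (PZ t)).
Variable xi : experiment PP Pi PZ.
Hypothesis HY_int : (Pr xi).-integrable setT
  (fun w => uncertainty L (predictive xi (rv_Y xi w))).

Let P := Pr xi.
Let Y := rv_Y xi.

(** A version of the predictive distribution all of whose values lie in the
    family. *)
Lemma patched_predictive :
  exists (k : {mfun obs xi >-> pprobability Z R}) (N : set (obs xi)),
  [/\ forall y, PP (k y), conditional_distribution P Y (rv_Z xi) k,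
      measurable N, distribution P Y N = 0 &
      forall y, ~ N y -> k y = predictive xi y].
Proof.
have [k [N [mN N0 kPP kE]]] :=
  ae_patched_kernel (PZ_in point) (predictive_in xi).
exists k, N; split => // B C mB mC; rewrite (Z_given_Y mB mC).
rewrite [LHS]integral_mkcond [RHS]integral_mkcond.
apply: (@integral_eq_off_null _ _ _ _ (Y @^-1` N)) => //.
  by rewrite -[X in measurable X]setTI; exact: measurable_funPT.
by move=> w Nw; rewrite !patchE kE.
Qed.

Lemma integral_theta (f : T -> \bar R) :
  measurable_fun setT f -> (forall t, 0 <= f t) ->
  \int[P]_w f (rv_theta xi w) = \int[Pi]_t f t.
Proof.
move=> mf f0; rewrite -(ge0_integral_distribution (rv_theta xi) mf f0).
by apply: eq_measure_integral => B mB _; exact: theta_prior.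
Qed.

Lemma integral_theta_uncertainty :
  P.-integrable setT (fun w => uncertainty L (PZ (rv_theta xi w))) /\
  \int[P]_w uncertainty L (PZ (rv_theta xi w)) =
  \int[Pi]_t uncertainty L (PZ t).
Proof.
have mH := measurable_int Pi HZ_int.
have iH : P.-integrable setT ((fun t => uncertainty L (PZ t)) \o rv_theta xi).
  apply/integrableP; split; first exact: measurableT_comp.
  rewrite (integral_theta (f := fun t => `|uncertainty L (PZ t)|))//.
    by move/integrableP: HZ_int => [].
  exact: measurableT_comp.
split => //; rewrite -[LHS](integral_distribution mH iH).
by apply: eq_measure_integral => B mB _; exact: theta_prior.
Qed.

(** The law of [Z] is the prior mean of the sampling distributions, hence common
    to all experiments. *)
Lemma predictive_marginal C : measurable C ->
  P (rv_Z xi @^-1` C) = \int[Pi]_t PZ t C.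
Proof.
move=> mC; rewrite -[X in P X]setTI -(preimage_setT (rv_theta xi)).
rewrite Z_given_theta// preimage_setT.
by rewrite (integral_theta (f := fun t => PZ t C))//; exact: measurable_kernel_set.
Qed.

(** Every criterion is the expected predictive uncertainty, up to the sign and
    to a constant. The predictive distribution is first replaced by its
    patched version, which changes each integrand on a null set only. *)
Lemma design_criteria :
  [/\ minimal_expected_loss L xi = expected_uncertainty L xi,
      minimal_expected_score L act xi = expected_uncertainty L xi,
      expected_discrepancy L act xi =
        expected_uncertainty L xi - \int[Pi]_t uncertainty L (PZ t) &
      dependence_ZY L xi =
        uncertainty L (distribution
          (distribution P (pairing (rv_Z xi) Y)) fst) -
        expected_uncertainty L xi].
Proof.
have [k [N [kPP YZk mN N0 kE]]] := patched_predictive.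
have mYN : measurable (Y @^-1` N).
  by rewrite -[X in measurable X]setTI; exact: measurable_funPT.
have mH := measurable_uncertainty L_meas L_dom act_meas kPP.
have EUE : expected_uncertainty L xi = \int[P]_w uncertainty L (k (Y w)).
  by apply: (integral_eq_off_null mYN N0) => w Nw; rewrite kE.
have H_int : P.-integrable setT (fun w => uncertainty L (k (Y w))).
  apply/integrableP; split; first exact: (measurableT_comp mH).
  rewrite (@integral_eq_off_null _ _ _ _ _ _
    (fun w => `|uncertainty L (predictive xi (Y w))|) mYN N0).
    by have /integrableP[] := HY_int.
  by move=> w Nw; rewrite kE.
have [iHZ HZE] := integral_theta_uncertainty.
have SYZ := conditional_distribution_pairing (Y_given_theta (e:=xi)) (YZ_indep (e:=xi)).
rewrite EUE; split.
- exact: (ereal_inf_loss L_meas PP_convex L_dom act_meas YZk kPP H_int).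
- exact: (ereal_inf_score L_meas PP_convex L_dom act_meas YZk kPP H_int).
- rewrite -HZE -(integral_discrepancy L_meas L_dom act_meas YZk kPP H_int PZ_in SYZ iHZ).
  by apply: (integral_eq_off_null mYN N0) => w Nw; rewrite kE.
- congr (_ - _); rewrite -[RHS](integral_distribution mH H_int).
  apply: (integral_eq_off_null mN); first exact: N0.
  by move=> y Ny; rewrite kE.
Qed.

End experiments.

(** * Equivalence of the criteria *)

Theorem mainTheorem2 (R : realType)
    (dZ : measure_display) (Z : measurableType dZ)
    (dA : measure_display) (A : measurableType dA)
    (dT : measure_display) (T : measurableType dT)
    (L : Z -> A -> \bar R) (PP : set (pprobability Z R))
    (act : pprobability Z R -> A)
    (Pi : probability T R) (PZ : {mfun T >-> pprobability Z R})
    (Xi : Type) (E : Xi -> experiment PP Pi PZ) (xs : Xi)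
    (L_gtNy : forall z a, -oo < L z a)
    (L_meas : measurable_fun [set: Z * A] (fun za => L za.1 za.2))
    (PP_convex : convex_family PP)
    (L_dom : has_domain L act PP)
    (act_meas : measurable_selection act PP)
    (PZ_in : forall t, PP (PZ t))
    (HZ_int : Pi.-integrable [set: T] (fun t => uncertainty L (PZ t)))
    (HY_int : forall xi : Xi, (Pr (E xi)).-integrable [set: sample (E xi)]
       (fun w => uncertainty L (predictive (E xi) (rv_Y (E xi) w)))) :
  [<-> forall xi : Xi,
         minimal_expected_loss L (E xs) <= minimal_expected_loss L (E xi);
       forall xi : Xi,
         minimal_expected_score L act (E xs)
         <= minimal_expected_score L act (E xi);
       forall xi : Xi,
         expected_uncertainty L (E xs) <= expected_uncertainty L (E xi);
       forall xi : Xi,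
         expected_discrepancy L act (E xs)
         <= expected_discrepancy L act (E xi);
       forall xi : Xi,
         dependence_ZY L (E xi) <= dependence_ZY L (E xs)].
Proof.
have EU_fin xi : expected_uncertainty L (E xi) \is a fin_num.
  exact: (integrable_fin_num measurableT (HY_int xi)).
have HZ_fin := integrable_fin_num measurableT HZ_int.
have crit xi := design_criteria L_meas PP_convex L_dom act_meas PZ_in HZ_int
  (HY_int xi).
(* The marginal law of [Z]: its values on measurable sets, hence its
   uncertainty, do not depend on the experiment. *)
pose law xi := distribution (distribution (Pr (E xi))
  (pairing (rv_Z (E xi)) (rv_Y (E xi)))) fst : pprobability Z R.
have lawE xi C : measurable C -> law xi C = \int[Pi]_t PZ t C.
  exact: predictive_marginal.
have c_fin : uncertainty L (law xs) \is a fin_num.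
  apply: (uncertainty_fin_num L_dom).
  exact: (PP_convex _ _ Pi PZ PZ_in (law xs) (lawE xs)).
have cE xi : uncertainty L (law xi) = uncertainty L (law xs).
  by apply: eq_uncertainty => C mC; rewrite !lawE.
tfae.
- move=> h xi; have [lE sE _ _] := crit xi; have [lE' sE' _ _] := crit xs.
  by rewrite sE sE' -lE -lE'.
- move=> h xi; have [_ sE _ _] := crit xi; have [_ sE' _ _] := crit xs.
  by rewrite -sE -sE'.
- move=> h xi; have [_ _ dE _] := crit xi; have [_ _ dE' _] := crit xs.
  by rewrite dE dE' leeB.
- move=> h xi; have [_ _ dE cE1] := crit xi; have [_ _ dE' cE1'] := crit xs.
  rewrite cE1 cE1' -/(law xi) -/(law xs) cE leeB//.
  by move: (h xi); rewrite dE dE' leeD2rE// fin_numN.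
- move=> h xi; have [lE _ _ cE1] := crit xi; have [lE' _ _ cE1'] := crit xs.
  move: (h xi); rewrite cE1 cE1' -/(law xi) -/(law xs) cE lE lE'.
  by rewrite leeD2lE// leeN2.
Qed.
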